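(* Let $L>0$, $N\in\mathbb N$, $h=\frac{L}{N+1}$, and let $(b_{ij})_{i,j=0}^{N+1}$ and $(b_{ij}^s)_{i,j=0}^{N+1}$ be the stiffness matrices of the logarithmic Laplacian $L_\Delta$ and of the fractional Laplacian $(-\Delta)^s$, respectively, with respect to the shape functions $\varphi_0,\dots,\varphi_{N+1}$. Then, for $i,j=0,\ldots,N+1$, $$b_{ij}=\partial_s b_{ij}^s\big|_{s=0}.$$
   Context: $\Omega=(0,L)$, $x_i=ih$ for $i=0,\dots,N+1$. For $i=1,\dots,N$, $\varphi_i(x)=\frac{x-x_{i-1}}h$ on $[x_{i-1},x_i]$, $\varphi_i(x)=\frac{x_{i+1}-x}{h}$ on $[x_i,x_{i+1}]$, and $\varphi_i=0$ elsewhere. Moreover $\varphi_0(x)=\frac{x_1-x}{h}$ on $[x_0,x_1]$ and $0$ elsewhere; $\varphi_{N+1}(x)=\frac{x-x_N}{h}$ on $[x_N,x_{N+1}]$ and $0$ elsewhere (so $\varphi_0$, $\varphi_{N+1}$ have a jump at $0$, resp. $L$). $b_{ij}=\mathcal E_L(\varphi_i,\varphi_j)$, where $$\mathcal E_L(u,v)=\frac12\int_{\mathbb R}\int_{x-1}^{x+1}\frac{(u(x)-u(y))(v(x)-v(y))}{|x-y|}\,dy\,dx-\iint_{|x-y|\ge1}\frac{u(x)v(y)}{|x-y|}\,dx\,dy+\rho_1\int_{\mathbb R}uv\,dx,$$ $\rho_1=2\ln2+\psi(\tfrac12)-\gamma$, $\psi=\Gamma'/\Gamma$, $\gamma=-\Gamma'(1)$.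 For $s\in(0,\tfrac12)$, $b^s_{ij}=\mathcal E_s(\varphi_i,\varphi_j)=\frac{c_{1,s}}2\int_{\mathbb R}\int_{\mathbb R}\frac{(\varphi_i(x)-\varphi_i(y))(\varphi_j(x)-\varphi_j(y))}{|x-y|^{1+2s}}\,dx\,dy$, with $c_{1,s}=4^s\pi^{-1/2}s(1-s)\frac{\Gamma(1/2+s)}{\Gamma(2-s)}$. At $s=0$, $(-\Delta)^0$ is the identity, i.e. $b_{ij}^0=\int_{\mathbb R}\varphi_i\varphi_j\,dx$, and $\partial_s|_{s=0}$ denotes the right derivative at $s=0$. *)

(* Defs.v *)
From HB Require Import structures.
From mathcomp Require Import all_boot all_order all_algebra.
From mathcomp Require Import all_classical all_reals all_analysis.

Set Implicit Arguments.
Unset Strict Implicit.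
Unset Printing Implicit Defensive.
Import Order.TTheory GRing.Theory Num.Theory.
Import numFieldNormedType.Exports.

Local Open Scope classical_set_scope.
Local Open Scope ring_scope.

Section Definitions.
Context {R : realType}.
Implicit Types (L s x : R) (N i : nat) (u v : R -> R).

Local Notation mu := (@lebesgue_measure R).

(* Euler's integral; meaningful for x > 0, the only range used below. *)
Definition Gamma x : R := \int[mu]_(t in `]0, +oo[) (t `^ (x - 1) * expR (- t)).

Definition digamma x : R := derive1 Gamma x / Gamma x.

Definition euler_gamma : R := - derive1 Gamma 1.

Definition rho1 : R := 2 * ln 2 + digamma 2^-1 - euler_gamma.

Definition c1 s : R :=
  4 `^ s * pi `^ (- 2^-1) * s * (1 - s) * (Gamma (2^-1 + s) / Gamma (2 - s)).

Definition mesh L N : R := L / N.+1%:R.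

Definition node L N i : R := i%:R * mesh L N.

Definition phi L N i x : R :=
  let h := mesh L N in
  if i == 0%N then
    if node L N 0 <= x <= node L N 1 then (node L N 1 - x) / h else 0
  else if i == N.+1 then
    if node L N N <= x <= node L N N.+1 then (x - node L N N) / h else 0
  else
    if node L N i.-1 <= x <= node L N i then (x - node L N i.-1) / h
    else if node L N i <= x <= node L N i.+1 then (node L N i.+1 - x) / h
    else 0.

(* In the kernels below, division by zero yields 0 on the diagonal x = y,
   a null set on which the numerators of the difference forms vanish.
   Since phi 0 and phi N.+1 jump, an inner integral may diverge for x at a
   jump point; the value 0 given by Rintegral there only affects a null set. *)
Definition energy_log u v : R :=
  2^-1 * (\int[mu]_x \int[mu]_(y in `[x - 1, x + 1])
            ((u x - u y) * (v x - v y) / `|x - y|))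
  - \int[(mu \x mu)%E]_(z in [set z | 1 <= `|z.1 - z.2|])
      (u z.1 * v z.2 / `|z.1 - z.2|)
  + rho1 * \int[mu]_x (u x * v x).

(* The order-zero operator is the identity, so its form is the L^2 product. *)
Definition energy_frac s u v : R :=
  if s == 0 then \int[mu]_x (u x * v x)
  else c1 s / 2 * (\int[mu]_x \int[mu]_y
         ((u x - u y) * (v x - v y) / `|x - y| `^ (1 + 2 * s))).

Definition stiffness_log L N : 'M[R]_N.+2 :=
  \matrix_(i, j) energy_log (phi L N i) (phi L N j).

Definition stiffness_frac s L N : 'M[R]_N.+2 :=
  \matrix_(i, j) energy_frac s (phi L N i) (phi L N j).

Definition is_right_derive (f : R -> R) (a l : R) : Prop :=
  (f (a + h) - f a) / h @[h --> 0^'+] --> l.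

End Definitions.

(* Main.v *)
From HB Require Import structures.
Require Import Defs.
From mathcomp Require Import all_boot all_order all_algebra.
From mathcomp Require Import all_classical all_reals all_analysis.
From mathcomp Require Import measurable_realfun.
From mathcomp Require Import ring lra.

(** The kernel of (-Delta)^s is c1 s / |x - y|^(1 + 2 s), where c1 s vanishes to
    first order at s = 0: c1 s = s * g s with g 0 = 1. Put u = phi_i, v = phi_j
    and W = int u v, and cut the double integral at |x - y| = 1.

    On |x - y| < 1 the singularity of the kernel is compensated by the
    increments of u and v, uniformly for small s, and this part, A_s, tends to
    its value A at s = 0. On |x - y| >= 1 the product of increments is expanded.
    The cross terms give - 2 C_s, with C_s the integral over this region of
    u(x) v(y) / |x - y|^(1 + 2 s), and C_s tends to C_0. The diagonal terms
    u(x) v(x) and u(y) v(y) give 2 W / s, because |t|^(-1 - 2 s) has integral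
    1 / s over |t| >= 1; they blow up, and against the prefactor s * g s / 2
    they produce g s * W, hence the identity at s = 0. Altogether
    (energy_frac_split)

      (E_s(u, v) - W) / s = g s / 2 * A_s - g s * C_s + (g s - 1) / s * W,

    which tends to A / 2 - C_0 + g'(0) W. What is left is g'(0) = rho1.

    Three points need work. First, phi_0 and phi_{N+1} jump, so that increments
    over t are O(|t|) only in the mean: shape functions have bounded variation,
    so the integral over x of |u x - u (x + t)| is O(|t|)
    (integral_broken_lipschitz_increment), and |t|^(-5/4) * |t| is integrable
    near 0; this dominates the near part for s <= 1 / 8. Second, the double
    integrals are handled in the coordinates (x, t) with y = x + t, where the
    kernel depends on t alone; translation invariance and Fubini justify the
    change of coordinates (Rintegral_increment, Rintegral_shear). Third, g'(0)
    involves the Gamma function at 1 / 2 and at 1. One exchange of integrals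
    (layer_cake_expRN) gives both Gamma (x + 1) = x * Gamma x and, from the
    Gaussian integral, Gamma (1 / 2) = sqrt pi; differentiability is obtained
    under the integral sign (derivable_Gamma). *)

Set Implicit Arguments.
Unset Strict Implicit.
Unset Printing Implicit Defensive.
Import Order.TTheory GRing.Theory Num.Theory.
Import numFieldNormedType.Exports.

Local Open Scope classical_set_scope.
Local Open Scope ring_scope.

(** * Invariance of the Lebesgue integral on the line *)

Section lebesgue_invariance.
Context {R : realType}.
Local Notation mu := (@lebesgue_measure R).
Implicit Types (f : R -> \bar R) (c : R).

Lemma measurable_addl c : measurable_fun [set: R] (fun x : R => c + x).
Proof. by apply: measurable_funD. Qed.

Lemma lebesgue_measure_shift c (A : set R) : measurable A ->
  pushforward mu (fun x : R => c + x : measurableTypeR R) A = mu A.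
Proof.
move=> mA; apply/esym/lebesgue_measure_unique => //=.
  exact: measurable_addl.
move=> mf _ [[a b]] _ <-; rewrite /pushforward.
rewrite (_ : _ @^-1` _ = `](a - c), (b - c)]%classic); last first.
  by apply/seteqP; split => x /=; rewrite !in_itv/=; lra.
rewrite !lebesgue_measure_itv/= !lte_fin ltrD2r.
by case: ifP => // _; rewrite !EFinB; congr EFin; ring.
Qed.

Lemma ge0_integral_shift c f : measurable_fun setT f ->
  (forall x, (0 <= f x)%E) ->
  (\int[mu]_x f (c + x)%R = \int[mu]_x f x)%E.
Proof.
move=> mf f0.
have := @ge0_integral_pushforward _ _ _ _ R
    (fun x : measurableTypeR R => c + x : measurableTypeR R)
    (measurable_addl c) mu setT f.
rewrite preimage_setT => <-//.
apply: eq_measure_integral => /= [|? A mA _]; first exact: measurable_addl.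
exact: lebesgue_measure_shift.
Qed.

Lemma integral_shift c f : measurable_fun setT f ->
  (\int[mu]_x f (c + x)%R = \int[mu]_x f x)%E.
Proof.
move=> mf; rewrite integralE [RHS]integralE; congr (_ - _)%E.
- rewrite -[RHS](ge0_integral_shift c)//; last exact: measurable_funepos.
  by apply: eq_integral => x _; rewrite funepos_comp.
- rewrite -[RHS](ge0_integral_shift c)//; last exact: measurable_funeneg.
  by apply: eq_integral => x _; rewrite funeneg_comp.
Qed.

Lemma ge0_integral_normr f : measurable_fun setT f ->
  (forall x, (0 <= f x)%E) ->
  (\int[mu]_x f `|x|%R = 2%:E * \int[mu]_(x in `[0%R, +oo[) f x)%E.
Proof.
move=> mf f0.
have mfn : measurable_fun setT (fun x : R => f `|x|).
  by apply: measurableT_comp.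
rewrite -(setUv `[0%R, +oo[%classic) ge0_integral_setU//=; last 3 first.
- exact: measurableC.
- by rewrite setUv.
- exact/disj_setPCl.
have -> : (2%:E = 1 + 1 :> \bar R)%E by rewrite -EFinD.
rewrite ge0_muleDl// mul1e; congr (_ + _)%E.
- apply: eq_integral => x; rewrite inE/= in_itv/= andbT => x0.
  by rewrite ger0_norm.
- rewrite setCitvr ge0_integration_by_substitution0//.
  rewrite -integral_itv_bndo_bndc; last first.
    by apply: measurable_funTS; apply: measurableT_comp.
  apply: eq_integral => x; rewrite inE/= in_itv/= => x0.
  by rewrite ltr0_norm.
Qed.

End lebesgue_invariance.

(** * Integrals of powers *)

Section power_integrals.
Context {R : realType}.
Local Notation mu := (@lebesgue_measure R).
Implicit Types (x a b p t r : R).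

Lemma powR_continuous_gt0 a (r : R) : 0 < r ->
  {for r, continuous (@powR R ^~ a)}.
Proof.
move=> r0; apply/differentiable_continuous/derivable1_diffP.
by apply: derivable_powR; rewrite in_itv/= r0.
Qed.

Lemma powRB1_continuous_within x a b : 0 < a ->
  {within `[a, b], continuous (fun r : R => x * r `^ (x - 1))}.
Proof.
move=> a0; apply: derivable_within_continuous => r.
rewrite in_itv/= => /andP[ar _].
apply: derivableM; first exact: derivable_cst.
by apply: derivable_powR; rewrite in_itv/= andbT (lt_le_trans a0).
Qed.

Lemma integral_powR_cc x a b : 0 < a -> a < b ->
  (\int[mu]_(r in `[a, b]) (x * r `^ (x - 1))%:E = (b `^ x - a `^ x)%:E)%E.
Proof.
move=> a0 ab; rewrite EFinB.
apply: (@continuous_FTC2 _ (fun r : R => x * r `^ (x - 1)) (@powR R ^~ x)) => //.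
- exact: powRB1_continuous_within.
- split.
  + move=> r; rewrite in_itv/= => /andP[ar _].
    by apply: derivable_powR; rewrite in_itv/= andbT (lt_trans a0).
  + by apply: cvg_at_right_filter; exact: powR_continuous_gt0.
  + by apply: cvg_at_left_filter; apply: powR_continuous_gt0; exact: lt_trans ab.
- move=> r; rewrite in_itv/= => /andP[ar _].
  by apply: powR_derive1; rewrite in_itv/= andbT (lt_trans a0).
Qed.

(** For x < 1 the integrand is unbounded near 0, where the fundamental theorem
    of calculus does not apply; the integral is reached as the monotone limit of
    those over the closed intervals from b / (n + 2) to b. *)
Lemma integral_powR_0b x b : 0 < x -> 0 < b ->
  (\int[mu]_(r in `]0%R, b[) (x * r `^ (x - 1))%:E = (b `^ x)%:E)%E.
Proof.
move=> x0 b0.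
have mf : measurable_fun setT (fun r : R => x * r `^ (x - 1)).
  by apply: measurable_funM => //; exact: measurable_powR.
rewrite integral_itv_bndo_bndc; last first.
  by apply/measurable_EFinP; exact: measurable_funTS.
pose F n := `[b / n.+2%:R, b]%classic.
have FE : `]0, b]%classic = \bigcup_n F n.
  apply/seteqP; split => r /=.
    rewrite in_itv/= => /andP[r0 rb].
    exists (Num.trunc (b / r)) => //=; rewrite /F/= in_itv/= rb andbT.
    rewrite ler_pdivrMr// mulrC -ler_pdivrMr//.
    by rewrite ltW// (lt_le_trans (truncnS_gt _))// ler_nat.
  move=> [n _]; rewrite /F/= !in_itv/= => /andP[+ ->]; rewrite andbT.
  by apply: lt_le_trans; rewrite divr_gt0.
have ndF : nondecreasing_seq F.
  move=> m n mn; rewrite subsetEset => r; rewrite /F/= !in_itv/= => /andP[+ ->].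
  rewrite andbT; apply: le_trans.
  by rewrite ler_pM2l// lef_pV2 ?posrE// ler_nat !ltnS.
have cv1 : (\int[mu]_(r in F n) (x * r `^ (x - 1))%:E)%E @[n --> \oo] -->
    (\int[mu]_(r in `]0%R, b]) (x * r `^ (x - 1))%:E)%E.
  rewrite FE; apply: ge0_nondecreasing_set_cvg_integral => //.
  - by move=> n; exact: measurable_itv.
  - by move=> n; apply/measurable_EFinP; exact: measurable_funTS.
  - by move=> n r _; rewrite lee_fin mulr_ge0 ?powR_ge0// ltW.
have cv2 : (\int[mu]_(r in F n) (x * r `^ (x - 1))%:E)%E @[n --> \oo] -->
    (b `^ x)%:E.
  apply: (@cvg_trans _ ((b `^ x - (b / n.+2%:R) `^ x)%:E @[n --> \oo])).
    apply: near_eq_cvg; near=> n; rewrite /F integral_powR_cc//.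
      by rewrite divr_gt0.
    by rewrite ltr_pdivrMr// ltr_pMr// ltr1n.
  apply: cvg_EFin; first exact: nearW.
  rewrite /comp/= -[X in _ --> X]subr0; apply: cvgB; first exact: cvg_cst.
  have /cvg_at_rightP := powR_cvg0 x0.
  apply; split; first by move=> n; rewrite divr_gt0.
  rewrite -(mulr0 b); apply: cvgM; first exact: cvg_cst.
  have := @cvg_harmonic R.
  by rewrite -(cvg_shiftS (harmonic : R^nat)); apply.
exact: cvg_unique cv1 cv2.
Unshelve. all: by end_near. Qed.

Lemma integrable_powR_01 a : -1 < a ->
  mu.-integrable `]0%R, 1%R[ (fun t => (t `^ a)%:E).
Proof.
move=> a1; have a10 : 0 < a + 1 by lra.
apply/integrableP; split.
  by apply/measurable_EFinP/measurable_funTS; exact: measurable_powR.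
have -> : (\int[mu]_(t in `]0%R, 1%R[) `|(t `^ a)%:E|)%E =
    (\int[mu]_(t in `]0%R, 1%R[) ((a + 1)^-1%:E * ((a + 1) * t `^ (a + 1 - 1))%:E))%E.
  apply: eq_integral => t _.
  by rewrite -EFinM mulKf ?gt_eqF// addrK gee0_abs// lee_fin powR_ge0.
rewrite ge0_integralZl_EFin//; last 3 first.
- by move=> t _; rewrite lee_fin mulr_ge0 ?powR_ge0// ltW.
- apply/measurable_EFinP/measurable_funTS; exact: measurable_funM.
- by rewrite invr_ge0 ltW.
by rewrite integral_powR_0b// -EFinM ltry.
Qed.

Lemma integral_powR_1y p : 0 < p ->
  (\int[mu]_(r in `[1%R, +oo[) (r `^ (- 1 - p))%:E = (p^-1)%:E)%E.
Proof.
move=> p0.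
rewrite (@ge0_continuous_FTC2y _ _ (fun r => - (p^-1 * r `^ (- p))) 1 0).
- by rewrite powR1 mulr1 EFinN oppeK add0e.
- by move=> r _; exact: powR_ge0.
- apply: continuous_in_subspaceT => r; rewrite inE/= in_itv/= andbT => r1.
  by apply: powR_continuous_gt0; lra.
- rewrite -oppr0 -(mulr0 p^-1); apply: cvgN; apply: cvgM; first exact: cvg_cst.
  apply/cvgrPdist_le => e e0; near=> r.
  have r0 : 0 < r by near: r; exact: nbhs_pinfty_gt.
  rewrite sub0r normrN ger0_norm ?powR_ge0// powRN.
  rewrite -(invrK e) lef_pV2 ?posrE ?powR_gt0 ?invr_gt0//.
  have -> : e^-1 = (e^-1 `^ p^-1) `^ p.
    by rewrite -powRrM mulVf ?gt_eqF// powRr1// invr_ge0 ltW.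
  apply: ge0_ler_powR; [exact: ltW|by rewrite nnegrE powR_ge0|
    by rewrite nnegrE ltW|].
  by near: r; exact: nbhs_pinfty_ge.
- move=> r r1; apply: derivableN; apply: derivableM; first exact: derivable_cst.
  by apply: derivable_powR; rewrite in_itv/= andbT; lra.
- apply: cvg_at_right_filter; apply: cvgN; apply: cvgM; first exact: cvg_cst.
  by apply: powR_continuous_gt0.
- move=> r; rewrite in_itv/= andbT => r1; have r0 : 0 < r by lra.
  have H := is_derive1_powR (- p) r0.
  rewrite derive1E; apply: derive_val.
  apply: is_derive_eq.
  rewrite -[_ *: _]/(_ * _) mulNr mulrN opprK mulKf ?gt_eqF// addrC.
Unshelve. all: by end_near. Qed.
End power_integrals.

(** * The Gamma function *)

Lemma integrableU d (T : measurableType d) (R : realType)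
    (m : {measure set T -> \bar R}) (A B : set T) (f : T -> \bar R) :
  measurable A -> measurable B ->
  m.-integrable A f -> m.-integrable B f -> m.-integrable (A `|` B) f.
Proof.
move=> mA mB /integrableP[mfA fA] /integrableP[mfB fB].
have mfU : measurable_fun (A `|` B) f by exact/measurable_funU.
have mafU := measurableT_comp (@abse_measurable R setT) mfU.
have mBA : measurable (B `\` A) by exact: measurableD.
have AB : A `|` B = A `|` (B `\` A) by rewrite setUDr setDv setD0.
apply/integrableP; split=> //.
rewrite AB ge0_integral_setU//=; last 2 first.
- by rewrite -AB.
- by apply/disj_setPS => x [] Ax [].
apply: lte_add_pinfty => //; apply: le_lt_trans fB.
apply: ge0_subset_integral => //=.
exact: (measurableT_comp (@abse_measurable R setT) mfB).
Qed.

Section Gamma_function.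
Context {R : realType}.
Local Notation mu := (@lebesgue_measure R).
Implicit Types (x a b p t r : R).

Lemma measurable_powRM_expRN (D : set R) a :
  measurable_fun D (fun t => (t `^ a * expR (- t))%:E).
Proof.
apply/measurable_EFinP/measurable_funTS/measurable_funM.
  exact: measurable_powR.
by apply: measurableT_comp => //; exact: measurable_expR.
Qed.

(** The integrand of Gamma (a + 1). Near 0 it is below t to the a; on the other
    side of 1, a single term of the exponential series, of degree at least
    a + 2, bounds it by a multiple of the inverse square of t. *)
Lemma integrable_powRM_expRN a : -1 < a ->
  mu.-integrable `]0%R, +oo[ (fun t => (t `^ a * expR (- t))%:E).
Proof.
move=> a1.
have -> : `]0, +oo[%classic = `]0, 1[ `|` `[1, +oo[ :> set R.
  by apply/seteqP; split => t /=; rewrite !in_itv/= !andbT; lra.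
apply: integrableU => //.
  apply: le_integrable (integrable_powR_01 a1) => //.
    exact: measurable_powRM_expRN.
  move=> t; rewrite /= in_itv/= => /andP[t0 t1]; rewrite lee_fin.
  rewrite !ger0_norm ?mulr_ge0 ?powR_ge0 ?expR_ge0//.
  by rewrite ler_piMr ?powR_ge0// expR_le1; lra.
pose n := Num.trunc (a + 2).
pose C : R := n.+1`!%:R.
have C0 : 0 < C by rewrite ltr0n fact_gt0.
have i2 : mu.-integrable `[1%R, +oo[ (fun t => (C * t `^ (- 1 - 1))%:E).
  apply/integrableP; split.
    apply/measurable_EFinP/measurable_funTS; exact: measurable_funM.
  under eq_integral do rewrite gee0_abs ?lee_fin ?mulr_ge0 ?powR_ge0 ?ltW// EFinM.
  rewrite ge0_integralZl_EFin ?ltW//.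
  - by rewrite integral_powR_1y// -EFinM ltry.
  - by move=> t _; rewrite lee_fin powR_ge0.
  - by apply/measurable_EFinP/measurable_funTS; exact: measurable_powR.
apply: le_integrable i2 => //; first exact: measurable_powRM_expRN.
move=> t; rewrite /= in_itv/= andbT => t1; rewrite lee_fin.
have t0 : 0 < t by lra.
rewrite !ger0_norm ?mulr_ge0 ?powR_ge0 ?expR_ge0 ?(ltW C0)//.
have -> : t `^ a = t `^ (- 1 - 1) * t `^ (a + 2).
  rewrite -powRD; last by rewrite (gt_eqF t0) implybT.
  by congr (t `^ _); ring.
rewrite [leRHS]mulrC -mulrA ler_pM2l ?powR_gt0// expRN ler_pdivrMr ?expR_gt0//.
have tn : t `^ (a + 2) <= t ^+ n.+1.
  rewrite -powR_mulrn ?(ltW t0)//; apply: ler_powR => //; apply: ltW.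
  exact: truncnS_gt.
apply: le_trans tn _; rewrite [leRHS]mulrC -ler_pdivrMr//.
by have := expR_ge1Dxn n (ltW t0); apply: le_trans; rewrite lerDr.
Qed.

Lemma integral_expRN_y a :
  (\int[mu]_(t in `[a, +oo[) (expR (- t))%:E = (expR (- a))%:E)%E.
Proof.
rewrite (@ge0_continuous_FTC2y _ _ (fun t => - expR (- t)) a 0).
- by rewrite EFinN oppeK add0e.
- by move=> t _; exact: expR_ge0.
- apply: continuous_subspaceT => t.
  by apply: continuous_comp; [exact: continuousN|exact: continuous_expR].
- by rewrite -oppr0; apply: cvgN; exact: cvgr_expR.
- by move=> t _; exact: ex_derive.
- apply: cvg_at_right_filter; apply: cvgN.
  by apply: continuous_comp; [exact: continuousN|exact: continuous_expR].
- move=> t _; rewrite derive1E derive_val.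
  by rewrite mulrN1 opprK.
Qed.

(** As expR (- m r) is the integral of expR (- t) over t > m r, the two sides
    are the same double integral, in the two orders of integration. Only
    nonnegative integrands occur, so no boundary terms have to be controlled, as
    they would in an integration by parts. *)
Lemma layer_cake_expRN (w m : R -> R) :
  measurable_fun setT w -> measurable_fun setT m ->
  (forall r, 0 < r -> 0 <= w r) -> (forall r, 0 < r -> 0 <= m r) ->
  (\int[mu]_(r in `]0%R, +oo[) (w r * expR (- m r))%:E =
   \int[mu]_(t in `]0%R, +oo[)
     ((expR (- t))%:E *
      \int[mu]_(r in `]0%R, +oo[ `&` [set r | (m r < t)%R]) (w r)%:E))%E.
Proof.
move=> mw mm w0 m0.
pose F (z : R * R) : \bar R :=
  (if (0 < z.1) && (m z.1 < z.2) then w z.1 * expR (- z.2) else 0)%:E.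
have mF : measurable_fun setT F.
  apply/measurable_EFinP; apply: measurable_fun_ifT => //.
  - apply: measurable_and; apply: measurable_fun_ltr => //.
    by apply: measurableT_comp.
  - apply: measurable_funM; first exact: measurableT_comp.
    apply: measurableT_comp; first exact: measurable_expR.
    exact: measurableT_comp.
have F0 z : (0 <= F z)%E.
  rewrite lee_fin; case: ifP => // /andP[z0 _].
  by rewrite mulr_ge0 ?expR_ge0 ?w0.
transitivity (\int[mu]_r \int[mu]_t F (r, t))%E.
  rewrite integral_mkcond; apply: eq_integral => r _; rewrite patchE/=.
  case: ifPn => [|]; rewrite ?inE ?notin_setE/= in_itv/= andbT => r0; last first.
    rewrite integral0_eq// => t _; rewrite /F/= ifF//.
    by apply/negbTE/negP => /andP[].
  transitivity (\int[mu]_(t in `]m r, +oo[) ((w r)%:E * (expR (- t))%:E))%E; last first.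
    rewrite integral_mkcond; apply: eq_integral => t _; rewrite patchE/F/= r0/=.
    case: ifPn => [|]; rewrite ?inE ?notin_setE/= in_itv/= andbT => mt.
      by rewrite mt.
    by move/negP/negbTE : mt => ->.
  have me : measurable_fun `]m r, +oo[ (fun t => (expR (- t))%:E).
    apply/measurable_EFinP/measurable_funTS.
    by apply: measurableT_comp => //; exact: measurable_expR.
  rewrite ge0_integralZl_EFin ?w0//.
  by rewrite integral_itv_obnd_cbnd// integral_expRN_y EFinM.
rewrite fubini_tonelli//.
rewrite [RHS]integral_mkcond; apply: eq_integral => t _; rewrite patchE/=.
case: ifPn => [|]; rewrite ?inE ?notin_setE/= in_itv/= andbT => t0; last first.
  rewrite integral0_eq// => r _; rewrite /F/= ifF//; apply/negbTE/negP => /andP[r0].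
  by rewrite ltNge (le_trans _ (m0 _ r0))// leNgt; apply/negP.
have mS : measurable (`]0%R, +oo[ `&` [set r | (m r < t)%R] : set R).
  apply: measurableI => //; rewrite -[X in measurable X]setTI.
  by apply: (@measurable_fun_ltr _ _ _ setT m (cst t)) => //.
rewrite -ge0_integralZl_EFin ?expR_ge0//; last 2 first.
- by move=> r []; rewrite /= in_itv/= andbT lee_fin => /w0.
- by apply/measurable_EFinP; exact: measurable_funTS.
rewrite [RHS]integral_mkcond; apply: eq_integral => r _; rewrite patchE/F/=.
case: ifPn => [/andP[r0 rt]|nrt].
  by rewrite mem_set ?EFinM 1?muleC//; split; rewrite /= ?in_itv/= ?r0.
rewrite memNset// => -[]; rewrite /= in_itv/= andbT => r0 rt.
by rewrite r0 rt in nrt.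
Qed.

(** The slices r < t of the layer cake have the integral of x * r `^ (x - 1)
    over them equal to t `^ x. *)
Lemma GammaD1 x : 0 < x -> Gamma (x + 1) = x * Gamma x.
Proof.
move=> x0; rewrite /Gamma -RintegralZl//; last first.
  by apply: integrable_powRM_expRN; lra.
congr fine; under [RHS]eq_integral do rewrite mulrA.
rewrite (@layer_cake_expRN (fun r => x * r `^ (x - 1)) id)//; last 3 first.
- by apply: measurable_funM => //; exact: measurable_powR.
- by move=> r _; rewrite mulr_ge0 ?powR_ge0 ?ltW.
- by move=> r; exact: ltW.
apply: eq_integral => t; rewrite inE/= in_itv/= andbT => t0.
rewrite addrK (_ : _ `&` _ = `]0%R, t[%classic); last first.
  apply/seteqP; split => r /=; rewrite !in_itv/= andbT; first by case=> ->.
  by move=> /andP[].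
by rewrite integral_powR_0b// -EFinM mulrC.
Qed.

Lemma Gamma1 : Gamma 1 = 1 :> R.
Proof.
rewrite /Gamma subrr.
rewrite (_ : \int[mu]_(t in _) _ = fine (expR (- 0))%:E); last first.
  congr fine; rewrite -(integral_expRN_y 0) -integral_itv_obnd_cbnd; last first.
    apply/measurable_EFinP/measurable_funTS.
    by apply: measurableT_comp => //; exact: measurable_expR.
  by apply: eq_integral => t _; rewrite powRr0 mul1r.
by rewrite /= oppr0 expR0.
Qed.

(** The layer cake of the Gaussian expR (- r ^+ 2) has the slices r < sqrt t,
    of length t `^ (1 / 2): the Gaussian integral over the half line is
    Gamma (3 / 2), that is, half of Gamma (1 / 2). *)
Lemma Gamma_half : Gamma 2^-1 = Num.sqrt pi :> R.
Proof.
have H : Gamma (2^-1 + 1) = Num.sqrt pi / 2 :> R.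
  rewrite /Gamma addrK -[RHS]/(fine (Num.sqrt pi / 2)%:E) -integral0y_gauss.
  congr fine; rewrite -integral_itv_obnd_cbnd; last first.
    by apply/measurable_EFinP/measurable_funTS; exact: measurable_gauss_fun.
  transitivity (\int[mu]_(r in `]0%R, +oo[) (1 * expR (- r ^+ 2))%:E)%E; last first.
    by apply: eq_integral => r _; rewrite mul1r.
  rewrite (@layer_cake_expRN (cst 1) (fun r => r ^+ 2))//; last first.
  - by move=> r _; exact: sqr_ge0.
  apply: eq_integral => t; rewrite inE/= in_itv/= andbT => t0.
  rewrite (_ : _ `&` _ = `]0%R, Num.sqrt t[%classic); last first.
    apply/seteqP; split => r /=; rewrite !in_itv/= ?andbT.
      move=> [r0 rt]; rewrite r0/= -(ger0_norm (ltW r0)) -sqrtr_sqr.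
      by rewrite ltr_sqrt.
    move=> /andP[r0 rt]; split => //.
    by rewrite -ltr_sqrt// sqrtr_sqr ger0_norm// ltW.
  rewrite integral_cst//= lebesgue_measure_itv/= lte_fin sqrtr_gt0 t0 oppr0 adde0 mul1e.
  by rewrite powR12_sqrt ?ltW// -EFinM mulrC.
have : Gamma (2^-1 + 1) = 2^-1 * Gamma 2^-1 :> R by apply: GammaD1; lra.
by rewrite H; lra.
Qed.
End Gamma_function.

(** * Derivative of the Gamma function and of the normalisation constant *)

Section Gamma_derivative.
Context {R : realType}.
Local Notation mu := (@lebesgue_measure R).
Implicit Types (x a b p t r s : R).

Lemma is_derive_powR_exponent t a x : 0 < t ->
  is_derive x 1 (fun y => t `^ (y - a)) (ln t * t `^ (x - a)).
Proof.
move=> t0; rewrite /powR gt_eqF//.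
apply: is_derive_eq.
by rewrite scaler0 add0r subr0 -[_ *: _]/(_ * _) mulr1 mulrC.
Qed.

(** The first term serves t < 1 and the second t >= 1; both come from
    ln y < y, applied to t `^ (- e) and to t. *)
Lemma normr_ln_le t e : 0 < t -> 0 < e -> `|ln t| <= e^-1 * t `^ (- e) + t.
Proof.
move=> t0 e0; have [t1|t1] := leP 1 t.
  rewrite ger0_norm ?ln_ge0// ler_wpDl ?mulr_ge0 ?powR_ge0 ?invr_ge0 ?(ltW e0)//.
  by rewrite ltW// ln_sublinear.
rewrite ler0_norm ?ln_le0 ?(ltW t1)// ler_wpDr ?(ltW t0)//.
rewrite ler_pdivlMl//.
have := ln_sublinear (powR_gt0 (- e) t0); rewrite ln_powR => /ltW.
by rewrite mulNr mulrN.
Qed.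

Lemma powR_le_add t a b x : 0 < t -> a <= x -> x <= b ->
  t `^ x <= t `^ a + t `^ b.
Proof.
move=> t0 ax xb; have [t1|t1] := leP 1 t.
  by rewrite ler_wpDl ?powR_ge0//; exact: ler_powR.
by rewrite ler_wpDr ?powR_ge0//; apply: ger_powR => //; rewrite t0 ltW.
Qed.

(** Differentiation under the integral sign. For exponents between u - 1 and
    v - 1, the derivative |ln t| * t `^ (x - 1) * expR (- t) is dominated by a
    combination of four integrands of Gamma; the loss t `^ (- e) due to the
    logarithm is affordable because e < u. *)
Lemma derivable_Gamma a : 0 < a -> derivable (@Gamma R) a 1.
Proof.
move=> a0; pose u := a / 2; pose v := 2 * a; pose e := u / 2.
have u0 : 0 < u by rewrite divr_gt0.
have e0 : 0 < e by rewrite divr_gt0.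
have eu : e < u by rewrite /e; lra.
have uv : u < v by rewrite /u /v; lra.
pose k b t : R := t `^ b * expR (- t).
have k0 b t : 0 <= k b t by rewrite mulr_ge0 ?powR_ge0 ?expR_ge0.
have ik b : -1 < b -> mu.-integrable `]0%R, +oo[ (EFin \o k b).
  exact: integrable_powRM_expRN.
pose G t := e^-1 * (k (u - 1 - e) t + k (v - 1 - e) t) + (k u t + k v t).
have dk x t : 0 < t -> is_derive x 1 (fun y => t `^ (y - 1) * expR (- t))
    (ln t * t `^ (x - 1) * expR (- t)).
  move=> t0; have H := is_derive_powR_exponent 1 x t0.
  by apply: is_derive_eq; rewrite scaler0 add0r -[_ *: _]/(_ * _) mulrC.
apply: (@derivable_under_integral _ _ _ mu
  (fun x t => t `^ (x - 1) * expR (- t)) `]0%R, +oo[ _ a u v _ _ _ G) => //.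
- by rewrite /= in_itv/= /u /v; apply/andP; split; lra.
- move=> x; rewrite /= in_itv/= => /andP[ux xv].
  by apply: integrable_powRM_expRN; lra.
- move=> x t _; rewrite /= in_itv/= andbT => t0.
  by case: (dk x t t0).
- by move=> t; rewrite /G addr_ge0// ?mulr_ge0 ?addr_ge0 ?invr_ge0 ?(ltW e0).
- have -> : EFin \o G = ((fun t => (e^-1)%:E * ((EFin \o k (u - 1 - e)%R) \+
      (EFin \o k (v - 1 - e)%R)) t) \+ ((EFin \o k u) \+ (EFin \o k v)))%E.
    by apply/funext => t; rewrite /= -!EFinD.
  apply: integrableD => //; last by apply: integrableD => //; apply: ik; lra.
  apply: integrableZl => //; apply: integrableD => //; apply: ik; rewrite /e; lra.
- move=> x t; rewrite /= !in_itv/= andbT => /andP[ux xv] t0.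
  rewrite /partial1of2 derive1E.
  have := dk x t t0 => /(@derive_val _ _ _ _ _ _ _) ->.
  rewrite !normrM (ger0_norm (powR_ge0 _ _)) (ger0_norm (expR_ge0 _)).
  have -> : G t = (e^-1 * t `^ (- e) + t) * (t `^ (u - 1) + t `^ (v - 1)) * expR (- t).
    have PB b : t `^ (b - 1 - e) = t `^ (b - 1) * t `^ (- e).
      by rewrite powRD// (gt_eqF t0) implybT.
    have PD b : t `^ b = t `^ (b - 1) * t.
      rewrite -[X in _ * X](powRr1 (ltW t0)) -powRD ?subrK//.
      by rewrite (gt_eqF t0) implybT.
    rewrite /G /k (PB u) (PB v) (PD u) (PD v); ring.
  rewrite ler_wpM2r ?expR_ge0// ler_pM ?normr_ge0 ?powR_ge0//.
    exact: normr_ln_le.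
  by apply: powR_le_add => //; lra.
Qed.

(** The normalisation constant without its zero at s = 0, and with the factor
    1 - s absorbed by Gamma (2 - s) = (1 - s) * Gamma (1 - s). *)
Definition c1_over_s s : R :=
  4 `^ s * pi `^ (- 2^-1) * (Gamma (2^-1 + s) / Gamma (1 - s)).

Lemma c1E s : s < 1 -> c1 s = s * c1_over_s s.
Proof.
move=> s1; rewrite /c1 /c1_over_s.
have -> : 2 - s = (1 - s) + 1 :> R by ring.
rewrite GammaD1; last by lra.
have [-> | G0] := eqVneq (Gamma (1 - s)) 0; first by rewrite mulr0 !invr0 !mulr0.
by field; rewrite G0/=; lra.
Qed.

Lemma powR_pi_half : pi `^ (- 2^-1) = (Num.sqrt pi)^-1 :> R.
Proof. by rewrite powRN powR12_sqrt// pi_ge0. Qed.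

Lemma sqrt_pi_neq0 : Num.sqrt pi != 0 :> R.
Proof. by rewrite gt_eqF// sqrtr_gt0 pi_gt0. Qed.

Lemma c1_over_s0 : c1_over_s 0 = 1.
Proof.
rewrite /c1_over_s powRr0 addr0 subr0 Gamma1 Gamma_half powR_pi_half.
by rewrite divr1 mul1r mulVf// sqrt_pi_neq0.
Qed.

(** The logarithmic derivative at 0 is the sum of ln 4, of digamma (1 / 2) and,
    from the denominator, of Gamma' (1); this is where rho1 comes from. *)
Lemma is_derive_c1_over_s : is_derive (0 : R) 1 c1_over_s rho1.
Proof.
have d2 : is_derive (0 : R) 1 (fun s => Gamma (2^-1 + s)) (derive1 Gamma 2^-1 : R).
  have H : is_derive (0 + 2^-1 : R) 1 (@Gamma R) (derive1 Gamma 2^-1).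
    rewrite add0r derive1E; apply/derivableP/derivable_Gamma; lra.
  under eq_fun do rewrite addrC.
  rewrite -[X in is_derive _ _ _ X]mulr1; apply: is_derive1_comp.
  exact: is_derive_shift.
have d1 : is_derive (0 : R) 1 (fun s => Gamma (1 - s)) (- derive1 Gamma 1 : R).
  have H : is_derive (1 - 0 : R) 1 (@Gamma R) (derive1 Gamma 1).
    by rewrite subr0 derive1E; apply/derivableP/derivable_Gamma.
  rewrite -mulrN1; apply: is_derive1_comp.
  apply: is_derive_eq. by rewrite add0r mul1r.
have d4 : is_derive (0 : R) 1 (fun s : R => 4 `^ s) (ln 4).
  have := @is_derive_powR_exponent 4 0 0 _.
  under eq_fun do rewrite subr0.
  by rewrite subr0 powRr0 mulr1; apply.
rewrite /c1_over_s.
have G1 : Gamma (1 - 0) != 0 :> R by rewrite subr0 Gamma1 oner_neq0.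
apply: is_derive_eq.
rewrite addr0 subr0 Gamma1 Gamma_half powRr0 powR_pi_half mul1r.
rewrite scaler0 -![_ *: _]/(_ * _).
rewrite /rho1 /digamma /euler_gamma opprK Gamma_half.
have -> : ln 4 = 2 * ln 2 :> R.
  by rewrite (_ : 4 = 2 ^+ 2) ?lnXn// ?mulr_natl//; ring.
move: sqrt_pi_neq0 (derive1 Gamma 1) (derive1 Gamma 2^-1) => /=.
move: (Num.sqrt pi) (ln 2) => q l q0 D1 D2.
by rewrite invr1 expr1n invr1; field.
Qed.

Lemma cvg_c1_over_s : c1_over_s s @[s --> 0^'+] --> (1 : R).
Proof.
have [d _] := is_derive_c1_over_s.
rewrite -c1_over_s0; apply: cvg_at_right_filter.
exact/differentiable_continuous/derivable1_diffP.
Qed.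

Lemma cvg_c1_over_s_slope :
  (c1_over_s s - 1) / s @[s --> 0^'+] --> (rho1 : R).
Proof.
have [d <-] := is_derive_c1_over_s.
apply: (@cvg_trans _ (s^-1 *: (c1_over_s (s *: 1 + 0) - c1_over_s 0) @[s --> 0^'+])).
  apply: near_eq_cvg; near=> s.
  by rewrite c1_over_s0 addr0 -[_ *: 1]/(_ * _) mulr1 -[_ *: _]/(_ * _) mulrC.
by apply: cvg_dnbhs_at_right; exact: d.
Unshelve. all: by end_near. Qed.
End Gamma_derivative.

(** * Double integrals: Fubini, shear and dominated convergence *)

Section plane_integrals.
Context {R : realType}.
Local Notation mu := (@lebesgue_measure R).
Local Notation mu2 := (mu \x mu)%E.
Implicit Types (F k r G : R * R -> R).

(** The inner integral may be infinite or undefined on a null set, where its real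
    value is 0; almost everywhere it agrees with the extended one. *)
Lemma Rintegral_prod12 F : mu2.-integrable setT (EFin \o F) ->
  \int[mu]_x \int[mu]_y F (x, y) = \int[mu2]_z F z.
Proof.
move=> iF; rewrite /Rintegral -(integral12_prod_meas1 iF)/=; congr fine.
have iG := integrable_fubini_F iF.
have mG := measurable_int _ iG.
apply: ae_eq_integral => //.
  by apply/measurable_EFinP; apply: measurableT_comp => //; exact: fine_measurable.
apply: filterS (integrable_ae measurableT iG) => x + _.
by move=> /(_ I) /fineK.
Qed.

Lemma measurable_prodP1 F x : measurable_fun setT F ->
  measurable_fun setT (fun y => F (x, y)).
Proof. by move=> mF; apply: measurableT_comp. Qed.

Lemma integrable_measurable_fun k :
  mu2.-integrable setT (EFin \o k) -> measurable_fun setT k.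
Proof. by move=> /measurable_int /measurable_EFinP. Qed.

Lemma measurable_shear : measurable_fun setT (fun z : R * R => (z.1, z.1 + z.2)).
Proof.
apply/measurable_fun_pair => //.
by apply: measurable_funD.
Qed.

Lemma measurable_swapT : measurable_fun setT (fun z : R * R => (z.2, z.1)).
Proof. exact/measurable_fun_pair. Qed.

Lemma Rintegral_shift c (f : R -> R) : measurable_fun setT f ->
  \int[mu]_x f (c + x) = \int[mu]_x f x.
Proof.
move=> mf; congr fine; apply: (@integral_shift _ c (EFin \o f)).
exact/measurable_EFinP.
Qed.

(** The shear (x, t) |-> (x, x + t) preserves the product measure, because each
    vertical line is translated. *)
Lemma integrable_shear k : mu2.-integrable setT (EFin \o k) ->
  mu2.-integrable setT (fun z => (k (z.1, z.1 + z.2)%R)%:E).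
Proof.
move=> ik; have mk := measurable_int _ ik.
have mk' : measurable_fun setT (fun z : R * R => (k (z.1, z.1 + z.2)%R)%:E).
  exact: measurableT_comp mk measurable_shear.
apply/(@integrable12ltyP _ _ _ _ R mu mu _ mk').
move/(@integrable12ltyP _ _ _ _ R mu mu _ mk): (ik); congr (_ < _)%E.
apply: eq_integral => x _ /=.
rewrite -[LHS](integral_shift x)//.
apply/measurable_EFinP; apply: (measurableT_comp (@normr_measurable R setT)).
by apply: measurable_prodP1; exact/measurable_EFinP.
Qed.

Lemma Rintegral_shear k : mu2.-integrable setT (EFin \o k) ->
  \int[mu2]_z k (z.1, z.1 + z.2) = \int[mu2]_z k z.
Proof.
move=> ik; rewrite -(Rintegral_prod12 ik) -(Rintegral_prod12 (integrable_shear ik)).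
apply: eq_Rintegral => x _ /=.
apply: (@Rintegral_shift x (fun y => k (x, y))); apply: measurable_prodP1.
exact: integrable_measurable_fun.
Qed.

Lemma integrable_swap k : mu2.-integrable setT (EFin \o k) ->
  mu2.-integrable setT (fun z => (k (z.2, z.1))%:E).
Proof.
move=> ik; have mk := measurable_int _ ik.
have mk' : measurable_fun setT (fun z : R * R => (k (z.2, z.1))%:E).
  exact: measurableT_comp mk measurable_swapT.
apply/(@integrable21ltyP _ _ _ _ R mu mu _ mk').
exact/(@integrable12ltyP _ _ _ _ R mu mu _ mk).
Qed.

Lemma Rintegral_prod21 F : mu2.-integrable setT (EFin \o F) ->
  \int[mu]_y \int[mu]_x F (x, y) = \int[mu2]_z F z.
Proof.
move=> iF; rewrite /Rintegral -(integral21_prod_meas1 iF)/=; congr fine.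
have iG := integrable_fubini_F (integrable_swap iF).
have mG := measurable_int _ iG.
apply: ae_eq_integral => //.
  by apply/measurable_EFinP; apply: measurableT_comp => //; exact: fine_measurable.
apply: filterS (integrable_ae measurableT iG) => x + _.
by move=> /(_ I) /fineK.
Qed.

Lemma Rintegral_swap k : mu2.-integrable setT (EFin \o k) ->
  \int[mu2]_z k (z.2, z.1) = \int[mu2]_z k z.
Proof.
by move=> ik; rewrite -(Rintegral_prod12 ik) -(Rintegral_prod21 (integrable_swap ik)).
Qed.

(** The form in which the iterated integrals of the energies appear: y is
    replaced by the increment y - x. *)
Lemma Rintegral_increment F : mu2.-integrable setT (EFin \o F) ->
  \int[mu]_x \int[mu]_y F (x, y - x) = \int[mu2]_z F z.
Proof.
move=> iF; rewrite -(Rintegral_prod12 iF); apply: eq_Rintegral => x _.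
rewrite -(@Rintegral_shift (- x) (fun t => F (x, t))); last first.
  by apply: measurable_prodP1; exact: integrable_measurable_fun.
by apply: eq_Rintegral => y _; rewrite addrC.
Qed.

(** The limit holds for c = 0 as well, where both sides are the inverse of 0. *)
Lemma cvg_powR_kernel (c : R) : 0 <= c ->
  (c `^ (1 + 2 * s))^-1 @[s --> 0^'+] --> c^-1.
Proof.
rewrite le_eqVlt => /predU1P[<-|c0].
  apply: (@cvg_trans _ (cst (0^-1 : R) @ 0^'+)); last exact: cvg_cst.
  by apply: near_eq_cvg; near=> s; rewrite powR0// gt_eqF// ltr_wpDr// mulr_ge0.
rewrite -[in X in _ --> X](powRr1 (ltW c0)).
apply: cvgV; first by rewrite gt_eqF// powR_gt0.
have -> : c `^ 1 = c `^ (1 + 2 * 0) by rewrite mulr0 addr0.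
have -> : (fun s : R => c `^ (1 + 2 * s)) = (fun s => expR ((1 + 2 * s) * ln c)).
  by apply/funext => s; rewrite /powR gt_eqF.
rewrite /powR (gt_eqF c0).
apply: cvg_at_right_filter; apply: continuous_cvg; first exact: continuous_expR.
apply: cvgM; last exact: cvg_cst.
apply: cvgD; first exact: cvg_cst.
by apply: cvgM; [exact: cvg_cst|exact: cvg_id].
Unshelve. all: by end_near. Qed.

Lemma cvg_Rintegral_kernel k r G (e : R) : 0 < e ->
  measurable_fun setT k -> measurable_fun setT r -> (forall z, 0 <= r z) ->
  mu2.-integrable setT (EFin \o G) ->
  (forall s z, 0 <= s <= e -> `|k z| / r z `^ (1 + 2 * s) <= G z) ->
  \int[mu2]_z (k z / r z `^ (1 + 2 * s)) @[s --> 0^'+] -->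
  \int[mu2]_z (k z / r z).
Proof.
move=> e0 mk mr r0 iG kG.
have mker s : measurable_fun setT (fun z => k z / r z `^ (1 + 2 * s)).
  under eq_fun do rewrite -powRN.
  apply: measurable_funM => //.
  exact: (measurableT_comp (measurable_powR _) mr).
have mker0 : measurable_fun setT (fun z => k z / r z).
  have := mker 0; congr (measurable_fun _ _).
  by apply/funext => z; rewrite mulr0 addr0 powRr1.
have nk s z : `|k z / r z `^ (1 + 2 * s)| = `|k z| / r z `^ (1 + 2 * s).
  by rewrite normrM (ger0_norm (_ : 0 <= (_ `^ _)^-1))// invr_ge0 powR_ge0.
have i0 : mu2.-integrable setT (fun z => (k z / r z)%:E).
  apply: le_integrable iG => //; first exact/measurable_EFinP.
  move=> z _; rewrite /= lee_fin (le_trans _ (ler_norm _))//.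
  have := kG 0 z; rewrite mulr0 addr0 powRr1// lexx (ltW e0) => /(_ isT).
  by rewrite normrM (ger0_norm (_ : 0 <= (_)^-1))// invr_ge0.
apply/cvg_at_rightP => u [u0 ucvg].
have [N _ uN] : \forall n \near \oo, u n <= e.
  by near=> n; apply/ltW; near: n; exact: (cvgr_lt 0 ucvg).
rewrite -(cvg_shiftn N); apply: fine_cvg.
rewrite /Rintegral fineK; last exact: integrable_fin_num.
apply: (@dominated_cvg _ _ _ mu2 _ _
  (fun n z => (k z / r z `^ (1 + 2 * u (n + N)%N))%:E) _ (EFin \o G)) => //=.
- by move=> n; apply/measurable_EFinP; exact: mker.
- move=> z _; apply: cvg_EFin; first exact: nearW.
  apply: cvgM; first exact: cvg_cst.
  have /cvg_at_rightP := cvg_powR_kernel (r0 z).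
  by move=> /(_ (fun n => u (n + N)%N)); apply; split => //; rewrite cvg_shiftn.
- move=> n z _; rewrite lee_fin nk; apply: kG.
  by rewrite (ltW (u0 _))/=; apply: uN; exact: leq_addl.
Unshelve. all: by end_near. Qed.

End plane_integrals.

(** * Functions that are Lipschitz up to jumps at the end points *)

Section broken_lipschitz_functions.
Context {R : realType}.
Local Notation mu := (@lebesgue_measure R).
Implicit Types (L K x y t : R) (u : R -> R).

(** What the proof needs to know of a shape function: Lipschitz on the closed
    interval from 0 to L and zero outside, so that jumps can occur at the two end
    points, and there only. *)
Record broken_lipschitz L K u : Prop := BrokenLipschitz {
  bl_measurable : measurable_fun setT u ;
  bl_itv01 : forall x, 0 <= u x <= 1 ;
  bl_supp : forall x, ~~ (0 <= x <= L) -> u x = 0 ;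
  bl_lip : forall x y, 0 <= x <= L -> 0 <= y <= L ->
    `|u x - u y| <= K * `|x - y| }.

(** A jump of u contributes to the increment only when x and x + t lie on
    different sides of it, hence only for x within |t| of 0 or of L. *)
Lemma broken_lipschitz_increment L K u : 0 <= K -> broken_lipschitz L K u ->
  forall x t, `|u x - u (x + t)| <= K * `|t| * \1_(`[0, L]%classic) x +
    (\1_(`[- `|t|, `|t|]%classic) x + \1_(`[L - `|t|, L + `|t|]%classic) x).
Proof.
move=> K0 [_ u01 us ul] x t.
have ind (A : set R) : 0 <= \1_A x :> R by rewrite indicE.
have dle1 : `|u x - u (x + t)| <= 1.
  by have := u01 x; have := u01 (x + t); rewrite ler_norml; lra.
have tt : - `|t| <= t <= `|t| by rewrite -ler_norml.
have [xin|xout] := boolP (0 <= x <= L);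
  have [yin|yout] := boolP (0 <= x + t <= L).
- have -> : \1_(`[0, L]%classic) x = 1 :> R by rewrite indicE mem_set.
  rewrite mulr1; apply: ler_wpDr; first by rewrite addr_ge0.
  apply: le_trans (ul _ _ xin yin) _.
  by rewrite opprD addrA subrr add0r normrN.
- apply: le_trans dle1 _; apply: ler_wpDl; first by rewrite !mulr_ge0.
  have [xt|xt] := leP 0 (x + t).
    have -> : \1_(`[L - `|t|, L + `|t|]%classic) x = 1 :> R.
      rewrite indicE mem_set//= in_itv/=.
      by move: yout; rewrite xt/= -ltNge => yout; apply/andP; split; lra.
    by rewrite lerDr.
  have -> : \1_(`[- `|t|, `|t|]%classic) x = 1 :> R.
    by rewrite indicE mem_set//= in_itv/=; apply/andP; split; lra.
  by rewrite lerDl.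
- apply: le_trans dle1 _; apply: ler_wpDl; first by rewrite !mulr_ge0.
  have [x0|x0] := leP 0 x.
    have -> : \1_(`[L - `|t|, L + `|t|]%classic) x = 1 :> R.
      rewrite indicE mem_set//= in_itv/=.
      by move: xout; rewrite x0/= -ltNge => xout; apply/andP; split; lra.
    by rewrite lerDr.
  have -> : \1_(`[- `|t|, `|t|]%classic) x = 1 :> R.
    by rewrite indicE mem_set//= in_itv/=; apply/andP; split; lra.
  by rewrite lerDl.
- by rewrite !us// subrr normr0 !addr_ge0// !mulr_ge0.
Qed.

(** In the mean, the jumps cost no more than the Lipschitz part: u has bounded
    variation, and its translation by t changes it by O(|t|) in L^1. *)
Lemma integral_broken_lipschitz_increment L K u : 0 <= L -> 0 <= K ->
  broken_lipschitz L K u -> forall t,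
  (\int[mu]_x `|u x - u (x + t)|%:E <= ((K * L + 4) * `|t|)%:E)%E.
Proof.
move=> L0 K0 bu t; have mu_u := bl_measurable bu.
have mi (a b : R) : measurable_fun setT (EFin \o (\1_(`[a, b]%classic) : R -> R)).
  by apply/measurable_EFinP; exact: measurable_indic.
have i0 (a b x : R) : (0 <= (\1_(`[a, b]%classic) x)%:E :> \bar R)%E.
  by rewrite lee_fin indicE.
have ii (a b : R) : a <= b ->
    (\int[mu]_x (\1_(`[a, b]%classic) x)%:E = (b - a)%:E)%E.
  move=> ab; rewrite integral_indic//= setIT lebesgue_measure_itv/= lte_fin.
  case: ltP => // ba.
  have -> : b = a by apply/eqP; rewrite eq_le ab ba.
  by rewrite subrr.
have t0 := normr_ge0 t.
apply: (@le_trans _ _ (\int[mu]_x ((K * `|t|)%:E * (\1_(`[0, L]%classic) x)%:E +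
   ((\1_(`[- `|t|, `|t|]%classic) x)%:E +
    (\1_(`[L - `|t|, L + `|t|]%classic) x)%:E)))%E).
  apply: ge0_le_integral => //.
  - apply/measurable_EFinP; apply: (measurableT_comp (@normr_measurable R setT)).
    apply: measurable_funB => //; apply: measurableT_comp => //.
    exact: measurable_funD.
  - apply: emeasurable_funD; last by apply: emeasurable_funD; exact: mi.
    by apply: emeasurable_funM; [exact: measurable_cst|exact: mi].
  - move=> x _; rewrite -EFinM -!EFinD lee_fin.
    exact: broken_lipschitz_increment.
rewrite ge0_integralD//; last 4 first.
- by move=> x _; rewrite mule_ge0// lee_fin mulr_ge0.
- by apply: emeasurable_funM; [exact: measurable_cst|exact: mi].
- by move=> x _; rewrite adde_ge0.
- by apply: emeasurable_funD; exact: mi.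
rewrite ge0_integralD//.
rewrite (@ge0_integralZl_EFin _ _ _ mu setT measurableT
  (EFin \o (\1_(`[0, L]%classic) : R -> R)))//; last by rewrite mulr_ge0.
rewrite !ii; [|lra..].
- by rewrite -EFinM -!EFinD lee_fin le_eqVlt; apply/orP; left; apply/eqP; ring.
- by move=> x _; exact: i0.
- exact: mi.
- exact: mi.
- exact: mi.
Qed.

End broken_lipschitz_functions.

Section shape_functions.
Context {R : realType}.
Implicit Types (L x : R) (N i : nat).

(** One formula for the three kinds of shape functions: the hat centred at the
    node, cut off to the closed interval from 0 to L. *)
Lemma phiE L N i x : 0 < L -> (i <= N.+1)%N ->
  phi L N i x = if 0 <= x <= L
    then Num.max 0 (mesh L N - `|x - node L N i|) / mesh L N else 0.
Proof.
move=> L0 iN; rewrite /phi /node.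
have h0 : 0 < mesh L N by rewrite divr_gt0.
have Lh : N.+1%:R * mesh L N = L by rewrite mulrC divfK.
set h := mesh L N in h0 Lh *.
have nh (k l : nat) : (k <= l)%N -> k%:R * h <= l%:R * h.
  by move=> kl; rewrite ler_pM2r// ler_nat.
have [->|i0] := eqVneq i 0%N.
  have := nh 1%N N.+1 isT; rewrite Lh mul0r mul1r subr0 => hL.
  case: ifPn => [/andP[x0 xh]|nx].
    rewrite x0 (le_trans xh hL)/= ger0_norm// max_r//; lra.
  case: ifPn => // /andP[x0 xL]; rewrite ger0_norm// max_l ?mul0r//.
  by move: nx; rewrite x0/= -ltNge; lra.
have [iN1|iN1] := eqVneq i N.+1.
  rewrite iN1 Lh; have := nh 0%N N isT; rewrite mul0r => Nh0.
  have LNh : L = N%:R * h + h by rewrite -Lh -natr1 mulrDl mul1r.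
  case: ifPn => [/andP[xa xL]|nx].
    rewrite xL (le_trans Nh0 xa)/= ler0_norm; last lra.
    rewrite max_r; last lra.
    by congr (_ / _); lra.
  case: ifPn => // /andP[x0 xL]; rewrite ler0_norm; last lra.
  rewrite max_l ?mul0r//.
  by move: nx; rewrite xL andbT -ltNge; lra.
have iN' : (i.+1 <= N.+1)%N by rewrite ltn_neqAle iN1.
have := nh i.+1 N.+1 iN'; rewrite Lh => ciL.
have := nh 0%N i.-1 isT; rewrite mul0r => c0.
have ci1 : i.+1%:R * h = i%:R * h + h by rewrite -natr1 mulrDl mul1r.
have ci0 : i%:R * h = i.-1%:R * h + h.
  by rewrite -{1}(prednK (_ : 0 < i)%N) ?lt0n// -natr1 mulrDl mul1r.
case: ifPn => [/andP[xa xb]|n1].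
  have -> : 0 <= x <= L by apply/andP; split; lra.
  rewrite ler0_norm; last lra.
  rewrite max_r; last lra.
  by congr (_ / _); lra.
case: ifPn => [/andP[xa xb]|n2].
  have -> : 0 <= x <= L by apply/andP; split; lra.
  rewrite ger0_norm; last lra.
  rewrite max_r; last lra.
  by congr (_ / _); lra.
case: ifPn => // _; rewrite max_l ?mul0r//.
move: n1 n2; rewrite !negb_and -!ltNge.
have [xc|xc] := leP x (i%:R * h).
  by rewrite ler0_norm; lra.
by rewrite gtr0_norm; lra.
Qed.

Lemma broken_lipschitz_phi L N i : 0 < L -> (i <= N.+1)%N ->
  broken_lipschitz L (mesh L N)^-1 (phi L N i).
Proof.
move=> L0 iN; have h0 : 0 < mesh L N by rewrite divr_gt0.
have -> : phi L N i = (fun x => if 0 <= x <= L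
    then Num.max 0 (mesh L N - `|x - node L N i|) / mesh L N else 0).
  by apply/funext => x; exact: phiE.
split.
- apply: measurable_fun_ifT => //.
    by apply: measurable_and; exact: measurable_fun_ler.
  apply: measurable_funM => //; apply: measurable_maxr => //.
  apply: measurable_funB => //.
  apply: (measurableT_comp (@normr_measurable R setT)).
  exact: measurable_funB.
- move=> x; case: ifP => // _; last by rewrite lexx ler01.
  rewrite divr_ge0 ?le_max ?lexx ?(ltW h0)//= ler_pdivrMr// mul1r.
  by rewrite ge_max (ltW h0)/= gerBl.
- by move=> x /negbTE ->.
- move=> x y -> ->; rewrite -mulrBl normrM.
  rewrite (ger0_norm (_ : 0 <= _^-1)) ?invr_ge0 ?(ltW h0)//.
  rewrite mulrC ler_wpM2l ?invr_ge0 ?(ltW h0)//.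
  set c := node L N i; set h := mesh L N.
  have := ler_normB (x - c) (y - c).
  have := lerB_dist (x - c) (y - c).
  have := lerB_dist (y - c) (x - c).
  have -> : x - c - (y - c) = x - y by ring.
  rewrite (_ : y - c - (x - c) = - (x - y)) ?normrN; last by ring.
  move: (`|x - c|) (`|y - c|) => a b ab ba _.
  by rewrite ler_norml; case: (leP 0 (h - a)) => ?; case: (leP 0 (h - b)) => ?; lra.
Qed.

End shape_functions.

(** * Tensor products and radial weights *)

Section tensor_products.
Context {R : realType}.
Local Notation mu := (@lebesgue_measure R).
Local Notation mu2 := (mu \x mu)%E.
Implicit Types (f g : R -> R).

Lemma integrable_tensor f g :
  mu.-integrable setT (EFin \o f) -> mu.-integrable setT (EFin \o g) ->
  mu2.-integrable setT (fun z => (f z.1 * g z.2)%:E).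
Proof.
move=> /integrableP[/measurable_EFinP mf if_] /integrableP[/measurable_EFinP mg ig].
have mfg : measurable_fun setT (fun z : R * R => (f z.1 * g z.2)%:E).
  apply/measurable_EFinP; apply: measurable_funM.
    exact: (measurableT_comp mf).
  exact: (measurableT_comp mg).
apply/(@integrable12ltyP _ _ _ _ R mu mu _ mfg).
have mag : measurable_fun setT (fun x => `|g x|%:E).
  by apply/measurable_EFinP; apply: (measurableT_comp (@normr_measurable R setT)).
have maf : measurable_fun setT (fun x => `|f x|%:E).
  by apply/measurable_EFinP; apply: (measurableT_comp (@normr_measurable R setT)).
rewrite (_ : (\int[mu]_x \int[mu]_y _)%E =
    (\int[mu]_x (`|f x|%:E * \int[mu]_y `|g y|%:E))%E); last first.
  apply: eq_integral => x _; rewrite -ge0_integralZl_EFin//.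
  by apply: eq_integral => y _; rewrite /= normrM EFinM.
rewrite ge0_integralZr//; last by rewrite integral_ge0.
apply: lte_mul_pinfty => //; first exact: integral_ge0.
by rewrite ge0_fin_numE// integral_ge0.
Qed.

Lemma Rintegral_tensor f g :
  mu.-integrable setT (EFin \o f) -> mu.-integrable setT (EFin \o g) ->
  \int[mu2]_z (f z.1 * g z.2) = \int[mu]_x f x * \int[mu]_x g x.
Proof.
move=> if_ ig; rewrite -(Rintegral_prod12 (integrable_tensor if_ ig))/=.
rewrite -RintegralZr//; apply: eq_Rintegral => x _.
by rewrite RintegralZl.
Qed.

(** The integrand of a convolution: the tensor product, sheared in its second
    factor and with the coordinates swapped. *)
Lemma integrable_conv f g :
  mu.-integrable setT (EFin \o f) -> mu.-integrable setT (EFin \o g) ->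
  mu2.-integrable setT (fun z => (f (z.2 + z.1) * g z.2)%:E).
Proof.
move=> if_ ig.
have H := integrable_swap (integrable_shear (integrable_tensor ig if_)).
by apply: eq_integrable H => // z _ /=; rewrite mulrC.
Qed.

Lemma Rintegral_conv f g :
  mu.-integrable setT (EFin \o f) -> mu.-integrable setT (EFin \o g) ->
  \int[mu2]_z (f (z.2 + z.1) * g z.2) = \int[mu]_x f x * \int[mu]_x g x.
Proof.
move=> if_ ig; rewrite mulrC -(Rintegral_tensor ig if_).
rewrite -(Rintegral_shear (integrable_tensor ig if_)).
rewrite -(Rintegral_swap (integrable_shear (integrable_tensor ig if_))).
by apply: eq_Rintegral => z _ /=; rewrite mulrC.
Qed.

End tensor_products.

Section radial_weights.
Context {R : realType}.
Local Notation mu := (@lebesgue_measure R).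
Implicit Types (a p s t : R).

Definition near_weight a t : R := if `|t| < 1 then `|t| `^ a else 0.
Definition far_weight a t : R := if 1 <= `|t| then `|t| `^ a else 0.

Lemma measurable_near_weight a : measurable_fun setT (near_weight a).
Proof.
apply: measurable_fun_ifT => //; first exact: measurable_fun_ltr.
exact: (measurableT_comp (measurable_powR _) (@normr_measurable R setT)).
Qed.

Lemma measurable_far_weight a : measurable_fun setT (far_weight a).
Proof.
apply: measurable_fun_ifT => //; first exact: measurable_fun_ler.
exact: (measurableT_comp (measurable_powR _) (@normr_measurable R setT)).
Qed.

Lemma near_weight_ge0 a t : 0 <= near_weight a t.
Proof. by rewrite /near_weight; case: ifP => // _; exact: powR_ge0. Qed.

Lemma far_weight_ge0 a t : 0 <= far_weight a t.
Proof. by rewrite /far_weight; case: ifP => // _; exact: powR_ge0. Qed.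

(** As a != 0, the weight vanishes at t = 0, so on the half line it is the
    restriction of the power to the open interval from 0 to 1. *)
Lemma integrable_near_weight a : -1 < a -> a != 0 ->
  mu.-integrable setT (EFin \o near_weight a).
Proof.
move=> a1 a0; have mw := measurable_near_weight a.
apply/integrableP; split; first exact/measurable_EFinP.
pose f (t : R) : \bar R := (near_weight a t)%:E.
rewrite (_ : (\int[mu]_t _)%E = (\int[mu]_t f `|t|%R)%E); last first.
  apply: eq_integral => t _ /=.
  by rewrite ger0_norm ?near_weight_ge0// /f /near_weight normr_id.
rewrite ge0_integral_normr; last 2 first.
- exact/measurable_EFinP.
- by move=> t; rewrite lee_fin near_weight_ge0.
rewrite (_ : (\int[mu]_(t in _) _)%E =
    (\int[mu]_(t in `]0%R, 1%R[) (t `^ a)%:E)%E); last first.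
  rewrite integral_mkcond [RHS]integral_mkcond; apply: eq_integral => t _.
  rewrite !patchE /f /near_weight !mem_setE !in_itv/= !andbT.
  case: (ltgtP 0 t) => [t0|//|<-]; last by rewrite normr0 ltr01 powR0.
  by rewrite gtr0_norm//; case: ifP.
rewrite lte_mul_pinfty//.
by have /integrable_lty := integrable_powR_01 a1; apply.
Qed.

Lemma integral_far_weight p : 0 < p ->
  (\int[mu]_t (far_weight (- 1 - p) t)%:E = (2 / p)%:E)%E.
Proof.
move=> p0; pose f (t : R) : \bar R := (far_weight (- 1 - p) t)%:E.
rewrite (_ : (\int[mu]_t _)%E = (\int[mu]_t f `|t|%R)%E); last first.
  by apply: eq_integral => t _ /=; rewrite /f /far_weight normr_id.
rewrite ge0_integral_normr; last 2 first.
- by apply/measurable_EFinP; exact: measurable_far_weight.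
- by move=> t; rewrite lee_fin far_weight_ge0.
rewrite (_ : (\int[mu]_(t in _) _)%E =
    (\int[mu]_(t in `[1%R, +oo[) (t `^ (- 1 - p))%:E)%E); last first.
  rewrite integral_mkcond [RHS]integral_mkcond; apply: eq_integral => t _.
  rewrite !patchE /f /far_weight !mem_setE !in_itv/= !andbT.
  have [t1|t1] := leP 1 t.
    by rewrite (le_trans ler01 t1) ger0_norm ?t1// (le_trans ler01 t1).
  by case: leP => // t0; rewrite ger0_norm// leNgt t1.
by rewrite integral_powR_1y// -EFinM.
Qed.

Lemma integrable_far_weight p : 0 < p ->
  mu.-integrable setT (EFin \o far_weight (- 1 - p)).
Proof.
move=> p0; apply/integrableP; split.
  by apply/measurable_EFinP; exact: measurable_far_weight.
rewrite (_ : (\int[mu]_t _)%E = (2 / p)%:E) ?ltry// -integral_far_weight//.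
by apply: eq_integral => t _ /=; rewrite ger0_norm ?far_weight_ge0.
Qed.

End radial_weights.

(** * The right derivative of the fractional energy *)

Section energies.
Context {R : realType}.
Local Notation mu := (@lebesgue_measure R).
Local Notation mu2 := (mu \x mu)%E.
Context (L K : R) (u v : R -> R).
Context (L0 : 0 <= L) (K0 : 0 <= K).
Context (bu : broken_lipschitz L K u) (bv : broken_lipschitz L K v).
Implicit Types (s x y t : R) (z : R * R).

Let mu_u : measurable_fun setT u := bl_measurable bu.
Let mu_v : measurable_fun setT v := bl_measurable bv.

Let measurable_add2 (f : R -> R) : measurable_fun setT f ->
  measurable_fun setT (fun z : R * R => f (z.1 + z.2)).
Proof. by move=> mf; apply: (measurableT_comp mf); exact: measurable_funD. Qed.

Let measurable_fst (f : R -> R) : measurable_fun setT f ->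
  measurable_fun setT (fun z : R * R => f z.1).
Proof. by move=> mf; exact: (measurableT_comp mf). Qed.

Let measurable_snd (f : R -> R) : measurable_fun setT f ->
  measurable_fun setT (fun z : R * R => f z.2).
Proof. by move=> mf; exact: (measurableT_comp mf). Qed.

(** Here z.1 is the point x and z.2 the increment y - x; in far_product below,
    z.2 is the point y itself. *)
Definition increments z : R := (u z.1 - u (z.1 + z.2)) * (v z.1 - v (z.1 + z.2)).

Definition near_increments z : R := if `|z.2| < 1 then increments z else 0.

Definition far_product z : R := if 1 <= `|z.1 - z.2| then u z.1 * v z.2 else 0.

Definition near_form s : R :=
  \int[mu2]_z (near_increments z / `|z.2| `^ (1 + 2 * s)).

Definition far_form s : R :=
  \int[mu2]_z (far_product z / `|z.1 - z.2| `^ (1 + 2 * s)).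

Definition mass : R := \int[mu]_x (u x * v x).

Let measurable_increments : measurable_fun setT increments.
Proof.
by apply: measurable_funM; apply: measurable_funB;
  [exact: measurable_fst|exact: measurable_add2|
   exact: measurable_fst|exact: measurable_add2].
Qed.

Let measurable_near_increments : measurable_fun setT near_increments.
Proof.
apply: measurable_fun_ifT => //; apply: measurable_fun_ltr => //.
exact: (measurable_snd (@normr_measurable R setT)).
Qed.

Let measurable_dist : measurable_fun setT (fun z : R * R => `|z.1 - z.2|).
Proof.
apply: (measurableT_comp (@normr_measurable R setT)).
exact: measurable_funB.
Qed.

Let measurable_far_product : measurable_fun setT far_product.
Proof.
apply: measurable_fun_ifT => //; first exact: measurable_fun_ler.
by apply: measurable_funM; [exact: measurable_fst|exact: measurable_snd].
Qed.

Let integrable_mass : mu.-integrable setT (EFin \o (fun x => u x * v x)).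
Proof.
have i1 : mu.-integrable setT (EFin \o (\1_(`[0, L]%classic) : R -> R)).
  exact: integrable_indic_itv.
apply: le_integrable i1 => //; first by apply/measurable_EFinP; exact: measurable_funM.
move=> x _; rewrite /= lee_fin indicE.
have := bl_itv01 bu x; have := bl_itv01 bv x => /andP[v0 v1] /andP[u0 u1].
have [xin|xout] := boolP (0 <= x <= L).
  by rewrite mem_set//= normr1 ger0_norm ?mulr_ge0// mulr_ile1.
by rewrite (bl_supp bu xout) mul0r normr0 normr_ge0.
Qed.

(** The exponent - 5 / 4 is - (1 + 2 * s) at s = 1 / 8. It is not integrable near
    0 by itself; the increment of u provides, in the mean, one more power of |t|,
    and - 1 / 4 is integrable. *)
Definition near_dominator z : R :=
  `|u z.1 - u (z.1 + z.2)| * near_weight (- (5 / 4)) z.2.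

Lemma integrable_near_dominator :
  mu2.-integrable setT (EFin \o near_dominator).
Proof.
have md : measurable_fun setT near_dominator.
  apply: measurable_funM.
    apply: (measurableT_comp (@normr_measurable R setT)).
    by apply: measurable_funB; [exact: measurable_fst|exact: measurable_add2].
  exact: (measurable_snd (measurable_near_weight _)).
have md' : measurable_fun setT (EFin \o near_dominator) by exact/measurable_EFinP.
apply/(@integrable21ltyP _ _ _ _ R mu mu _ md').
pose w : R -> R := near_weight (- (1 / 4)).
have iw : mu.-integrable setT (EFin \o w).
  by apply: integrable_near_weight; [lra|rewrite lt_eqF//; lra].
have C0 : 0 <= K * L + 4 by rewrite addr_ge0 ?mulr_ge0.
apply: (@le_lt_trans _ _ (\int[mu]_t ((K * L + 4)%:E * (w t)%:E))%E).
  apply: ge0_le_integral => //.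
  - by move=> t _; apply: integral_ge0.
  - apply: (@measurable_fun_fubini_tonelli_G _ _ _ _ R mu
      (abse \o (EFin \o near_dominator))) => //.
      exact: (measurableT_comp (@abse_measurable R setT)).
    by move=> z; exact: abse_ge0.
  - apply: emeasurable_funM; first exact: measurable_cst.
    by apply/measurable_EFinP; exact: measurable_near_weight.
  - move=> t _.
    rewrite (_ : (\int[mu]_x _)%E = (\int[mu]_x
        ((near_weight (- (5 / 4)) t)%:E * `|u x - u (x + t)|%:E))%E); last first.
      apply: eq_integral => x _ /=; rewrite -EFinM /near_dominator /=.
      by rewrite ger0_norm ?mulr_ge0 ?near_weight_ge0// mulrC.
    rewrite ge0_integralZl_EFin ?near_weight_ge0//; last first.
      apply/measurable_EFinP; apply: (measurableT_comp (@normr_measurable R setT)).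
      apply: measurable_funB => //; apply: (measurableT_comp mu_u).
      exact: measurable_funD.
    apply: (@le_trans _ _ ((near_weight (- (5 / 4)) t)%:E *
        ((K * L + 4) * `|t|)%:E)%E).
      apply: lee_wpmul2l; first by rewrite lee_fin near_weight_ge0.
      exact: integral_broken_lipschitz_increment bu t.
    rewrite -EFinM -EFinM lee_fin /w /near_weight.
    case: ifP => t1; last by rewrite mul0r mulr0.
    rewrite mulrCA ler_wpM2l//.
    have [->|t0] := eqVneq `|t| 0; first by rewrite mulr0 powR_ge0.
    have -> : - (1 / 4) = - (5 / 4) + 1 :> R by lra.
    by rewrite powRD ?t0 ?implybT// powRr1.
rewrite ge0_integralZl_EFin//; last 2 first.
- by move=> t _; rewrite lee_fin near_weight_ge0.
- by apply/measurable_EFinP; exact: measurable_near_weight.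
apply: lte_mul_pinfty => //.
by have /integrable_lty := iw; apply.
Qed.

Lemma near_kernel_le s z : 0 <= s <= 1 / 8 ->
  `|near_increments z| / `|z.2| `^ (1 + 2 * s) <= near_dominator z.
Proof.
move=> /andP[s0 s8]; rewrite /near_increments /near_dominator /near_weight.
case: ifP => z1; last by rewrite normr0 mul0r mulr0.
have [z0|z0] := eqVneq z.2 0.
  by rewrite /increments z0 addr0 !subrr mul0r normr0 !mul0r.
have nz : 0 < `|z.2| by rewrite normr_gt0.
apply: ler_pM; [by []|by rewrite invr_ge0 powR_ge0| |].
  rewrite /increments normrM ler_piMr//.
  have := bl_itv01 bv z.1; have := bl_itv01 bv (z.1 + z.2).
  by rewrite ler_norml; lra.
rewrite -powRN; apply: ger_powR; last by lra.
by rewrite nz ltW.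
Qed.

(** At distance at least 1 the kernel is at most 1. *)
Lemma far_kernel_le s z : 0 <= s ->
  `|far_product z| / `|z.1 - z.2| `^ (1 + 2 * s) <=
  \1_(`[0, L]%classic) z.1 * \1_(`[0, L]%classic) z.2.
Proof.
move=> s0; rewrite /far_product !indicE.
case: ifP => z1; last by rewrite normr0 mul0r mulr_ge0.
have := bl_itv01 bu z.1; have := bl_itv01 bv z.2 => /andP[v0 v1] /andP[u0 u1].
have [xin|xout] := boolP (0 <= z.1 <= L); last first.
  by rewrite (bl_supp bu xout) mul0r normr0 mul0r mulr_ge0.
have [yin|yout] := boolP (0 <= z.2 <= L); last first.
  by rewrite (bl_supp bv yout) mulr0 normr0 mul0r mulr_ge0.
rewrite !mem_set//= mulr1 ger0_norm ?mulr_ge0//.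
rewrite mulr_ile1 ?mulr_ge0 ?invr_ge0 ?powR_ge0// ?mulr_ile1//.
rewrite invf_le1 ?powR_gt0//; last by lra.
rewrite -[leLHS](powRr0 `|z.1 - z.2|); apply: ler_powR => //; lra.
Qed.

Let integrable_far_dominator : mu2.-integrable setT
  (EFin \o (fun z => \1_(`[0, L]%classic) z.1 * \1_(`[0, L]%classic) z.2 : R)).
Proof. by apply: integrable_tensor; exact: integrable_indic_itv. Qed.

Lemma cvg_near_form : near_form s @[s --> 0^'+] --> near_form 0.
Proof.
rewrite [X in _ --> X](_ : _ = \int[mu2]_z (near_increments z / `|z.2|)); last first.
  by apply: eq_Rintegral => z _; rewrite mulr0 addr0 powRr1.
apply: (@cvg_Rintegral_kernel _ _ (fun z => `|z.2|) near_dominator (1 / 8)) => //.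
- exact: (measurable_snd (@normr_measurable R setT)).
- exact: integrable_near_dominator.
- exact: near_kernel_le.
Qed.

Lemma cvg_far_form : far_form s @[s --> 0^'+] --> far_form 0.
Proof.
rewrite [X in _ --> X](_ : _ = \int[mu2]_z (far_product z / `|z.1 - z.2|)); last first.
  by apply: eq_Rintegral => z _; rewrite mulr0 addr0 powRr1.
apply: (@cvg_Rintegral_kernel _ _ (fun z => `|z.1 - z.2|) _ 1 _ _ _ _
  integrable_far_dominator) => //.
by move=> s z /andP[s0 _]; exact: far_kernel_le.
Qed.

Let measurable_kernel (k r : R * R -> R) s : measurable_fun setT k ->
  measurable_fun setT r ->
  measurable_fun setT (fun z => k z / r z `^ (1 + 2 * s)).
Proof.
move=> mk mr; under eq_fun do rewrite -powRN.
by apply: measurable_funM => //; exact: (measurableT_comp (measurable_powR _) mr).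
Qed.

Lemma integrable_near_kernel s : 0 <= s <= 1 / 8 ->
  mu2.-integrable setT (fun z => (near_increments z / `|z.2| `^ (1 + 2 * s))%:E).
Proof.
move=> s08; apply: le_integrable integrable_near_dominator => //.
  apply/measurable_EFinP; apply: measurable_kernel => //.
  exact: (measurable_snd (@normr_measurable R setT)).
move=> z _; rewrite /= lee_fin normrM.
rewrite (ger0_norm (_ : 0 <= _^-1)) ?invr_ge0 ?powR_ge0//.
exact: le_trans (near_kernel_le _ s08) (ler_norm _).
Qed.

Lemma integrable_far_kernel s : 0 <= s ->
  mu2.-integrable setT (fun z => (far_product z / `|z.1 - z.2| `^ (1 + 2 * s))%:E).
Proof.
move=> s0; apply: le_integrable integrable_far_dominator => //.
  by apply/measurable_EFinP; apply: measurable_kernel.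
move=> z _; rewrite /= lee_fin normrM.
rewrite (ger0_norm (_ : 0 <= _^-1)) ?invr_ge0 ?powR_ge0//.
exact: le_trans (far_kernel_le _ s0) (ler_norm _).
Qed.

(** For |x - y| >= 1 the product of increments is expanded. Each of the two
    diagonal terms u x * v x and u y * v y gives the mass times the integral 1 / s
    of the far kernel, and the two cross terms are equal by symmetry. *)
Lemma energy_frac_split s : 0 < s -> s <= 1 / 8 ->
  energy_frac s u v =
  c1 s / 2 * (near_form s + (2 / s * mass - 2 * far_form s)).
Proof.
move=> s0 s8; rewrite /energy_frac gt_eqF//; congr (_ * _).
pose ke z := increments z / `|z.2| `^ (1 + 2 * s).
pose kn z := near_increments z / `|z.2| `^ (1 + 2 * s).
pose kf z := far_product z / `|z.1 - z.2| `^ (1 + 2 * s).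
pose q : R -> R := far_weight (- 1 - 2 * s).
pose w x := u x * v x.
have s20 : 0 < 2 * s by rewrite mulr_gt0.
have iq : mu.-integrable setT (EFin \o q) by exact: integrable_far_weight.
have Iq : \int[mu]_t q t = s^-1.
  by rewrite /Rintegral integral_far_weight//= invfM mulrA divff ?mul1r.
have ikn : mu2.-integrable setT (EFin \o kn).
  by apply: integrable_near_kernel; rewrite ltW.
have ikf : mu2.-integrable setT (EFin \o kf).
  by apply: integrable_far_kernel; rewrite ltW.
pose k1 z := w z.1 * q z.2.
pose k2 z := w (z.2 + z.1) * q z.2.
pose k3 z := kf (z.1, z.1 + z.2).
pose k4 z := kf (z.1 + z.2, z.1).
have keE : ke = (fun z => kn z + ((k1 z + k2 z) - (k3 z + k4 z))).
  apply/funext => -[x t]; rewrite /ke /kn /k1 /k2 /k3 /k4 /kf /w /q.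
  rewrite /near_increments /far_product /far_weight /=.
  have -> : x - (x + t) = - t by ring.
  have -> : x + t - x = t by ring.
  rewrite normrN (addrC t x).
  rewrite (_ : -1 - 2 * s = - (1 + 2 * s)) ?powRN; last by ring.
  case: ltP => t1; last by rewrite /increments/= mul0r; ring.
  by rewrite !mulr0 !mul0r !addr0 subr0 addr0.
have i1 : mu2.-integrable setT (EFin \o k1).
  exact: integrable_tensor integrable_mass iq.
have i2 : mu2.-integrable setT (EFin \o k2).
  exact: integrable_conv integrable_mass iq.
have i3 : mu2.-integrable setT (EFin \o k3) by exact: integrable_shear ikf.
have i4 : mu2.-integrable setT (EFin \o k4).
  exact: integrable_shear (integrable_swap ikf).
have I1 : \int[mu2]_z k1 z = mass / s.
  by rewrite (Rintegral_tensor integrable_mass iq) Iq.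
have I2 : \int[mu2]_z k2 z = mass / s.
  by rewrite (Rintegral_conv integrable_mass iq) Iq.
have I3 : \int[mu2]_z k3 z = far_form s by exact: Rintegral_shear ikf.
have I4 : \int[mu2]_z k4 z = far_form s.
  by rewrite (Rintegral_shear (integrable_swap ikf)) (Rintegral_swap ikf).
(* Only the integrals of the four terms matter from here on. *)
clearbody k1 k2 k3 k4.
have i12 : mu2.-integrable setT (EFin \o (fun z => k1 z + k2 z)).
  exact: integrableD i1 i2.
have i34 : mu2.-integrable setT (EFin \o (fun z => k3 z + k4 z)).
  exact: integrableD i3 i4.
have i1234 : mu2.-integrable setT (EFin \o (fun z => (k1 z + k2 z) - (k3 z + k4 z))).
  exact: integrableB i12 i34.
have ike : mu2.-integrable setT (EFin \o ke).
  rewrite keE; exact: integrableD ikn i1234.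
transitivity (\int[mu2]_z ke z).
  rewrite -(Rintegral_increment ike); apply: eq_Rintegral => x _.
  apply: eq_Rintegral => y _; rewrite /ke /increments /= [x + (y - x)]addrC subrK.
  by rewrite distrC.
rewrite keE (RintegralD _ ikn i1234)//; congr (_ + _).
rewrite (RintegralB measurableT i12 i34).
rewrite (RintegralD measurableT i1 i2).
rewrite (RintegralD measurableT i3 i4).
by rewrite I1 I2 I3 I4; field; rewrite gt_eqF.
Qed.

(** The near part has the closed ball |x - y| <= 1 in one description and the open
    ball in the other; they differ by two points on each vertical line. *)
Lemma energy_logE : energy_log u v = 2^-1 * near_form 0 - far_form 0 + rho1 * mass.
Proof.
rewrite /energy_log; congr (_ * _ - _ + _).
- pose kn z := near_increments z / `|z.2| `^ (1 + 2 * 0).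
  have ikn : mu2.-integrable setT (EFin \o kn).
    by apply: integrable_near_kernel; rewrite lexx/=; lra.
  rewrite /near_form -/kn -(Rintegral_increment ikn); apply: eq_Rintegral => x _.
  rewrite {1}/Rintegral; rewrite integral_itv_bndoo; last first.
    apply/measurable_EFinP/measurable_funTS.
    under eq_fun do rewrite -powR_inv1//.
    apply: measurable_funM.
      by apply: measurable_funM; apply: measurable_funB.
    apply: (measurableT_comp (measurable_powR _)).
    apply: (measurableT_comp (@normr_measurable R setT)).
    exact: measurable_funB.
  rewrite -/(Rintegral _ _ _) Rintegral_mkcond; apply: eq_Rintegral => y _.
  rewrite patchE mem_setE in_itv/= /kn /near_increments /increments/= mulr0 addr0 powRr1//.
  rewrite [x + (y - x)]addrC subrK (distrC y) ltr_norml.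
  have -> : (x - 1 < y < x + 1) = (- 1 < x - y < 1) by apply/idP/idP; lra.
  by case: ifP => //; rewrite mul0r.
- rewrite Rintegral_mkcond; apply: eq_Rintegral => z _.
  rewrite patchE /far_product mulr0 addr0 powRr1//=.
  have [zf|zf] := boolP (1 <= `|z.1 - z.2|); first by rewrite mem_set.
  by rewrite memNset ?mul0r//; exact/negP.
Qed.

(** With g s = c1 s / s and g 0 = 1, the difference quotient is
    g s / 2 * near_form s - g s * far_form s + (g s - 1) / s * mass: the factor
    2 / s of the mass in the splitting is exactly what s * g s / 2 cancels. *)
Theorem is_right_derive_energy_frac :
  is_right_derive (fun s => energy_frac s u v) 0 (energy_log u v).
Proof.
rewrite /is_right_derive energy_logE.
apply: (@cvg_trans _ ((c1_over_s s * 2^-1 * near_form s - c1_over_s s * far_form s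
    + (c1_over_s s - 1) / s * mass) @[s --> 0^'+])).
  apply: near_eq_cvg; near=> s.
  have s0 : 0 < s by near: s; exact: nbhs_right_gt.
  have s8 : s <= 1 / 8 by near: s; apply: nbhs_right_le; lra.
  rewrite add0r energy_frac_split// c1E; last by lra.
  rewrite /energy_frac eqxx -/mass; field.
  by rewrite gt_eqF.
have cg := @cvg_c1_over_s R.
apply: cvgD; last by apply: cvgM; [exact: cvg_c1_over_s_slope|exact: cvg_cst].
apply: cvgB; last first.
  by rewrite -[X in _ --> X]mul1r; apply: cvgM => //; exact: cvg_far_form.
have : c1_over_s s * 2^-1 * near_form s @[s --> 0^'+] --> 1 * 2^-1 * near_form 0.
  apply: cvgM; last exact: cvg_near_form.
  by apply: cvgM => //; exact: cvg_cst.
by rewrite mul1r.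
Unshelve. all: by end_near. Qed.

End energies.

Theorem lemma5p1 (R : realType) (L : R) (N : nat) (hL : 0 < L)
    (i j : 'I_N.+2) :
  is_right_derive (fun s : R => stiffness_frac s L N i j) 0
    (stiffness_log L N i j).
Proof.
under eq_fun do rewrite mxE.
rewrite mxE; apply: (@is_right_derive_energy_frac _ L (mesh L N)^-1).
- exact: ltW.
- by rewrite invr_ge0 ltW// divr_gt0.
- by apply: broken_lipschitz_phi => //; exact: ltn_ord i.
- by apply: broken_lipschitz_phi => //; exact: ltn_ord j.
Qed.
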